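(* Let $w,c,d,\mathit{ch},b,t\ge 0$ be real numbers with $w\ge c$ and $\mathit{ch}>2w$, and put $z=w-c+d-\mathit{ch}$. If $d>c+\mathit{ch}$, $b<c$ and $t>z+d-b$, and the players LDR and FLR are rational, then Game 4 always terminates at the terminal node $v_{13}$ of Game 3. That is: in every sequential equilibrium of Game 4, LDR's action at the root is $\neg init$ with probability $1$, so play enters Game 3 with probability $1$ through the branch following $\neg init$; and in every sequential equilibrium of Game 3, the terminal node $v_{13}$ is reached with probability $1$.
   Context: Conventions. Games are finite two-player extensive-form games with imperfect information. A behavior strategy $s_i$ of player $i$ assigns to each information set of $i$ a probability distribution over the actions available there (independently across information sets); it is completely mixed if all actions get positive probability. A belief system $\beta$ assigns to each information set a probability distribution over its nodes. An assessment is a pair $(s,\beta)$ with $s=(s_1,s_2)$ a profile of behavior strategies. Player $i$'s expected payoff at a node $h$ is $u_i(s;h)=\sum_{\zeta}\Pr[\zeta\mid(s,h)]\,u_i(\zeta)$ (sum over terminal nodes $\zeta$), and at an information set $\mathcal I$ of player $i$ it is $u_i(s;\mathcal I,\beta)=\sum_{h\in\mathcal I}\beta(h)u_i(s;h)$. $(s,\beta)$ is sequentially rational if $u_i(s;\mathcal I,\beta)\ge u_i((s_i',s_{-i});\mathcal I,\beta)$ for every player $i$, every information set $\mathcal I$ of $i$ and every behavior strategy $s_i'$ of $i$. It is consistent if there are completely mixed profiles $s^k\to s$ such that the beliefs $\beta^k$ induced by $s^k$ via Bayes' rule converge to $\beta$. A sequential equilibrium is an assessment that is sequentially rational and consistent.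 Rational players play according to a sequential equilibrium, and ''always terminates at a node'' means that the node is reached with probability $1$. The symbol $\mathit{ch}$ is a single real parameter. Game 3. Players OTH (utility $u_1$) and TRA (utility $u_2$). At the root $v_0$ (TRA) the actions are $\neg report$ (to $v_1$), $(report, y'=f(x))$ (to $v_2$), $(report, y'\ne f(x))$ (to $v_3$). OTH then moves at information set $\{v_1,v_2,v_3\}$ with actions $f(x), r, other$, leading, in this order, from $v_1$ to $v_4,v_5,v_6$; from $v_2$ to $v_7,v_8,v_9$; from $v_3$ to $v_{10},v_{11},v_{12}$. TRA then moves at the information sets $\{v_4,v_5,v_6\}$, $\{v_7,v_8,v_9\}$, $\{v_{10},v_{11},v_{12}\}$, with actions $f(x),r,other$, leading, in this order, from $v_j$ ($4\le j\le 12$) to the terminal nodes $v_{3j+1},v_{3j+2},v_{3j+3}$. (The action labels $f(x), r, other$ are formal symbols.) Payoffs $(u_1,u_2)$: $v_{13}:(w-c,w-c)$; $v_{14},v_{15}:(z,-d)$; $v_{16},v_{19}:(-d,z)$; $v_{17}:(w,w)$; $v_{18},v_{20},v_{21}:(-d,-d)$; $v_{22},v_{31}:(w-c,w-c-\mathit{ch})$; $v_{23},v_{24}:(z,w-c-d)$; $v_{25},\dots,v_{30}:(-d,z)$; $v_{32},v_{33}:(z,-d)$; $v_{34},v_{37}:(-d,z)$; $v_{35},v_{36},v_{38},v_{39}:(-d,-d)$. Game 4. Players LDR (utility $u_1$) and FLR (utility $u_2$). At the root $v_0$, LDR chooses $\neg init$ (then the players play Game 3) or $init$ (to $v_1$).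 At $v_1$, FLR chooses $\neg collude$ (then the players play Game 3) or $collude$ (to $v_2$). Each of the two branches leading to Game 3 is represented by a single terminal node with the payoffs of the node $v_{13}$ of Game 3, namely $(w-c,w-c)$. At $v_2$, FLR chooses $\neg report$ (to $v_3$), $(report,y'=f(x))$ (to $v_4$) or $(report,y'\neq f(x))$ (to $v_5$). LDR then moves at information set $\{v_3,v_4,v_5\}$ with actions $f(x),r,other$, leading, in this order, from $v_3$ to $v_6,v_7,v_8$; from $v_4$ to $v_9,v_{10},v_{11}$; from $v_5$ to $v_{12},v_{13},v_{14}$. FLR then moves at the information sets $\{v_6,v_7,v_8\}$, $\{v_9,v_{10},v_{11}\}$, $\{v_{12},v_{13},v_{14}\}$ with actions $f(x),r,other$, leading, in this order, from $v_j$ ($6\le j\le 14$) to the terminal nodes $v_{3j-3},v_{3j-2},v_{3j-1}$. The nodes $v_0$, $v_1$, $v_2$ are singleton information sets. Payoffs $(u_1,u_2)$: $v_{15}:(w-c,\,w-c)$; $v_{16}:(z-t-b,\,-d+t+b)$; $v_{17}:(z,\,-d)$; $v_{18}:(-d+t,\,z-t)$; $v_{19}:(w-b,\,w+b)$; $v_{20}:(-d+t,\,-d-t)$; $v_{21}:(-d,\,z)$; $v_{22}:(-d-t-b,\,-d+t+b)$; $v_{23}:(-d,\,-d)$; $v_{24}:(w-c,\,w-c-\mathit{ch})$; $v_{25}:(z-t-b,\,-d+w-c+t+b)$; $v_{26}:(z,\,-d+w-c)$; $v_{27}:(-d+t,\,z-t)$; $v_{28}:(-d-b,\,z+b)$;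 $v_{29}:(-d+t,\,z-t)$; $v_{30}:(-d,\,z)$; $v_{31}:(-d-t-b,\,z+t+b)$; $v_{32}:(-d,\,z)$; $v_{33}:(w-c,\,w-c-\mathit{ch})$; $v_{34}:(z-t-b,\,-d+t+b)$; $v_{35}:(z,\,-d)$; $v_{36}:(-d+t,\,z-t)$; $v_{37}:(-d-b,\,-d+b)$; $v_{38}:(-d+t,\,-d-t)$; $v_{39}:(-d,\,z)$; $v_{40}:(-d-t-b,\,-d+t+b)$; $v_{41}:(-d,\,-d)$. *)

(* Defs.v *)
From HB Require Import structures.
From mathcomp Require Import all_boot all_order all_algebra.
From mathcomp Require Import zify.
From mathcomp Require Import all_classical all_reals all_analysis.

Set Implicit Arguments.
Unset Strict Implicit.
Unset Printing Implicit Defensive.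

Import Order.TTheory GRing.Theory Num.Theory.
Import numFieldNormedType.Exports.

Local Open Scope classical_set_scope.
Local Open Scope ring_scope.

Inductive player := P1 | P2.

Definition player_code (i : player) : nat := if i is P1 then 0%N else 1%N.
Lemma player_code_inj : injective player_code.
Proof. by do 2!case. Qed.
HB.instance Definition _ := Equality.copy player (inj_type player_code_inj).

(* [info h = None] means that [h] is terminal; an information set [I] is the
   set of nodes [h] with [info h = Some I].  The values of [child h a] for [a]
   not available at [h], and of [payoff i h] for [h] not terminal, are
   irrelevant.  The last five fields say that the edges form a tree with root
   [root_node] and that no information set is empty or without actions. *)
Record game (R : realType) := Game {
  node : finType;
  iset : eqType;
  action : eqType;
  root_node : node;
  info : node -> option iset;
  owner : iset -> player;
  avail : iset -> seq action;
  child : node -> action -> node;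
  payoff : player -> node -> R;
  edge : rel node :=
    fun h h' => if info h is Some J then h' \in map (child h) (avail J)
                else false;
  avail_uniq : forall I, uniq (avail I) && (avail I != [::]);
  iset_inhabited : forall I, exists h, info h = Some I;
  root_no_parent : forall h, ~~ edge h root_node;
  parent_unique : forall h h' I I' a a',
    info h = Some I -> info h' = Some I' -> a \in avail I -> a' \in avail I' ->
    child h a = child h' a' -> h = h' /\ a = a';
  root_connected : forall h, connect edge root_node h
}.

Arguments root_node {R} g.
Arguments info {R} g h.
Arguments owner {R} g I.
Arguments avail {R} g I.
Arguments child {R} g h a.
Arguments payoff {R} g i h.

Section SequentialEquilibrium.
Variables (R : realType) (G : game R).
Implicit Types (i : player) (h : node G) (I : iset G) (a : action G).

(* Only the values at the information sets of the player concerned, on the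
   actions available there, are ever used. *)
Definition strategy := iset G -> action G -> R.
Definition profile := player -> strategy.
Definition belief := node G -> R.

Definition behavior i (si : strategy) : Prop :=
  forall I, owner G I = i ->
    (forall a, a \in avail G I -> 0 <= si I a) /\
    \sum_(a <- avail G I) si I a = 1.

Definition behavior_profile (s : profile) : Prop := forall i, behavior i (s i).

Definition completely_mixed (s : profile) : Prop :=
  behavior_profile s /\
  forall I a, a \in avail G I -> 0 < s (owner G I) I a.

Definition belief_system (beta : belief) : Prop :=
  forall I, (forall h, info G h = Some I -> 0 <= beta h) /\
            \sum_(h | info G h == Some I) beta h = 1.

(* Probability that play starting at [h] visits [h'] within [n] moves. *)
Fixpoint pr_within (n : nat) (s : profile) (h h' : node G) : R :=
  if h == h' then 1
  else if n is m.+1 then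
    if info G h is Some J then
      \sum_(a <- avail G J)
        s (owner G J) J a * pr_within m s (child G h a) h'
    else 0
  else 0.

(* A path of the tree has fewer than [#|node G|] moves. *)
Definition pr (s : profile) (h h' : node G) : R := pr_within #|node G| s h h'.

Definition payoff_node i (s : profile) h : R :=
  \sum_(zeta | info G zeta == None) pr s h zeta * payoff G i zeta.

Definition payoff_iset i (s : profile) I (beta : belief) : R :=
  \sum_(h | info G h == Some I) beta h * payoff_node i s h.

Definition deviate (s : profile) i (si : strategy) : profile :=
  fun j => if j == i then si else s j.

Definition sequentially_rational (s : profile) (beta : belief) : Prop :=
  forall i I, owner G I = i -> forall si : strategy, behavior i si ->
    payoff_iset i (deviate s i si) I beta <= payoff_iset i s I beta.

Definition bayes (s : profile) I h : R :=
  pr s (root_node G) h / \sum_(h' | info G h' == Some I) pr s (root_node G) h'.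

Definition consistent (s : profile) (beta : belief) : Prop :=
  exists sk : nat -> profile,
    [/\ forall k, completely_mixed (sk k),
        forall I a, a \in avail G I ->
          (fun k => sk k (owner G I) I a) @ \oo --> s (owner G I) I a
      & forall I h, info G h = Some I ->
          (fun k => bayes (sk k) I h) @ \oo --> beta h].

Definition sequential_equilibrium (s : profile) (beta : belief) : Prop :=
  [/\ behavior_profile s, belief_system beta,
      sequentially_rational s beta & consistent s beta].

End SequentialEquilibrium.

Inductive move :=
  | NotInit | Init
  | NotCollude | Collude
  | NotReport | ReportEq | ReportNeq (* ReportEq: report with y' = f(x) *)
  | Fx | Rr | Other.

Definition move_code (a : move) : nat :=
  match a with
  | NotInit => 0%N | Init => 1%N | NotCollude => 2%N | Collude => 3%N
  | NotReport => 4%N | ReportEq => 5%N | ReportNeq => 6%N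
  | Fx => 7%N | Rr => 8%N | Other => 9%N
  end.
Lemma move_code_inj : injective move_code.
Proof. by do 2!case. Qed.
HB.instance Definition _ := Equality.copy move (inj_type move_code_inj).

(* A payoff pair is (u_1, u_2). *)
Definition pick_payoff (R : realType) (i : player) (u : R * R) : R :=
  if i is P1 then u.1 else u.2.

(* In [game3], P1 is OTH, P2 is TRA and element j of 'I_40 is the node v_j. *)

Inductive iset3 := I3_v0 | I3_v1_3 | I3_v4_6 | I3_v7_9 | I3_v10_12.

Definition iset3_code (I : iset3) : nat :=
  match I with
  | I3_v0 => 0%N | I3_v1_3 => 1%N | I3_v4_6 => 2%N
  | I3_v7_9 => 3%N | I3_v10_12 => 4%N
  end.
Lemma iset3_code_inj : injective iset3_code.
Proof. by do 2!case. Qed.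
HB.instance Definition _ := Equality.copy iset3 (inj_type iset3_code_inj).

Definition info3 (v : nat) : option iset3 :=
  match v with
  | 0%N => Some I3_v0
  | 1%N | 2%N | 3%N => Some I3_v1_3
  | 4%N | 5%N | 6%N => Some I3_v4_6
  | 7%N | 8%N | 9%N => Some I3_v7_9
  | 10%N | 11%N | 12%N => Some I3_v10_12
  | _ => None
  end.

Definition owner3 (I : iset3) : player := if I is I3_v1_3 then P1 else P2.

Definition avail3 (I : iset3) : seq move :=
  if I is I3_v0 then [:: NotReport; ReportEq; ReportNeq]
  else [:: Fx; Rr; Other].

(* The three actions at v_j lead, in order, to v_(3j+1), v_(3j+2), v_(3j+3). *)
Definition next3 (v : 'I_40) (a : move) : 'I_40 :=
  if info3 v is Some J then inord (3 * v + 1 + index a (avail3 J))%N else v.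

Definition payoff3 (R : realType) (w c d ch z : R) (v : nat) : R * R :=
  match v with
  | 13%N => (w - c, w - c)
  | 14%N | 15%N => (z, - d)
  | 16%N => (- d, z)
  | 17%N => (w, w)
  | 18%N => (- d, - d)
  | 19%N => (- d, z)
  | 20%N | 21%N => (- d, - d)
  | 22%N => (w - c, w - c - ch)
  | 23%N | 24%N => (z, w - c - d)
  | 25%N | 26%N | 27%N | 28%N | 29%N | 30%N => (- d, z)
  | 31%N => (w - c, w - c - ch)
  | 32%N | 33%N => (z, - d)
  | 34%N => (- d, z)
  | 35%N | 36%N => (- d, - d)
  | 37%N => (- d, z)
  | 38%N | 39%N => (- d, - d)
  | _ => (0, 0)
  end.

(* In [game4], P1 is LDR, P2 is FLR and element j <= 41 of 'I_44 is the node
   v_j; elements 42 and 43 are the terminal nodes that stand for [game3] after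
   NotInit and after NotCollude respectively. *)

Inductive iset4 :=
  I4_v0 | I4_v1 | I4_v2 | I4_v3_5 | I4_v6_8 | I4_v9_11 | I4_v12_14.

Definition iset4_code (I : iset4) : nat :=
  match I with
  | I4_v0 => 0%N | I4_v1 => 1%N | I4_v2 => 2%N | I4_v3_5 => 3%N
  | I4_v6_8 => 4%N | I4_v9_11 => 5%N | I4_v12_14 => 6%N
  end.
Lemma iset4_code_inj : injective iset4_code.
Proof. by do 2!case. Qed.
HB.instance Definition _ := Equality.copy iset4 (inj_type iset4_code_inj).

Definition info4 (v : nat) : option iset4 :=
  match v with
  | 0%N => Some I4_v0
  | 1%N => Some I4_v1
  | 2%N => Some I4_v2
  | 3%N | 4%N | 5%N => Some I4_v3_5
  | 6%N | 7%N | 8%N => Some I4_v6_8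
  | 9%N | 10%N | 11%N => Some I4_v9_11
  | 12%N | 13%N | 14%N => Some I4_v12_14
  | _ => None
  end.

Definition owner4 (I : iset4) : player :=
  match I with I4_v0 | I4_v3_5 => P1 | _ => P2 end.

Definition avail4 (I : iset4) : seq move :=
  match I with
  | I4_v0 => [:: NotInit; Init]
  | I4_v1 => [:: NotCollude; Collude]
  | I4_v2 => [:: NotReport; ReportEq; ReportNeq]
  | _ => [:: Fx; Rr; Other]
  end.

Definition game3_after_notinit : 'I_44 := inord 42.
Definition game3_after_notcollude : 'I_44 := inord 43.

(* For 2 <= j <= 14 the three actions at v_j lead, in order, to v_(3j-3),
   v_(3j-2), v_(3j-1). *)
Definition next4 (v : 'I_44) (a : move) : 'I_44 :=
  match info4 v with
  | Some I4_v0 => if a == NotInit then game3_after_notinit else inord 1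
  | Some I4_v1 => if a == NotCollude then game3_after_notcollude else inord 2
  | Some J => inord (3 * v - 3 + index a (avail4 J))%N
  | None => v
  end.

Definition payoff4 (R : realType) (w c d ch b t z : R) (v : nat) : R * R :=
  match v with
  | 15%N => (w - c, w - c)
  | 16%N => (z - t - b, - d + t + b)
  | 17%N => (z, - d)
  | 18%N => (- d + t, z - t)
  | 19%N => (w - b, w + b)
  | 20%N => (- d + t, - d - t)
  | 21%N => (- d, z)
  | 22%N => (- d - t - b, - d + t + b)
  | 23%N => (- d, - d)
  | 24%N => (w - c, w - c - ch)
  | 25%N => (z - t - b, - d + w - c + t + b)
  | 26%N => (z, - d + w - c)
  | 27%N => (- d + t, z - t)
  | 28%N => (- d - b, z + b)
  | 29%N => (- d + t, z - t)
  | 30%N => (- d, z)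
  | 31%N => (- d - t - b, z + t + b)
  | 32%N => (- d, z)
  | 33%N => (w - c, w - c - ch)
  | 34%N => (z - t - b, - d + t + b)
  | 35%N => (z, - d)
  | 36%N => (- d + t, z - t)
  | 37%N => (- d - b, - d + b)
  | 38%N => (- d + t, - d - t)
  | 39%N => (- d, z)
  | 40%N => (- d - t - b, - d + t + b)
  | 41%N => (- d, - d)
  | 42%N | 43%N => payoff3 w c d ch z 13
  | _ => (0, 0)
  end.

Lemma info3E (v : nat) I : info3 v = Some I -> (v <= 12)%N.
Proof. by do 13!(case: v => // v). Qed.

Lemma index3 I a : a \in avail3 I -> (index a (avail3 I) < 3)%N.
Proof. by rewrite -index_mem; case: I. Qed.

Lemma next3E (h : 'I_40) I a : info3 h = Some I -> a \in avail3 I ->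
  next3 h a = (3 * h + 1 + index a (avail3 I))%N :> nat.
Proof.
move=> hI aI; rewrite /next3 hI inordK //.
by have := info3E hI; have := index3 aI; lia.
Qed.

Definition edge3 : rel 'I_40 := fun h h' =>
  if info3 h is Some J then h' \in map (next3 h) (avail3 J) else false.

Lemma avail3_uniq I : uniq (avail3 I) && (avail3 I != [::]).
Proof. by case: I. Qed.

Lemma iset3_inhabited I : exists h : 'I_40, info3 h = Some I.
Proof.
case: I; [exists (inord 0)|exists (inord 1)|exists (inord 4)
  |exists (inord 7)|exists (inord 10)]; by rewrite inordK.
Qed.

Lemma root3_no_parent h : ~~ edge3 h ord0.
Proof.
rewrite /edge3; case hI: (info3 h) => [I|//].
by apply/negP => /mapP[a aI /(congr1 val)/=]; rewrite (next3E hI aI); lia.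
Qed.

Lemma index_avail_inj (T : eqType) (s : seq T) a a' :
  a \in s -> index a s = index a' s -> a = a'.
Proof.
move=> aI e; have a'I : a' \in s by rewrite -index_mem -e index_mem.
by rewrite -(nth_index a aI) -(nth_index a a'I) e.
Qed.

Lemma parent3_unique (h h' : 'I_40) I I' a a' :
  info3 h = Some I -> info3 h' = Some I' ->
  a \in avail3 I -> a' \in avail3 I' ->
  next3 h a = next3 h' a' -> h = h' /\ a = a'.
Proof.
move=> hI hI' aI aI' /(congr1 val)/=.
rewrite (next3E hI aI) (next3E hI' aI') => e.
have i3 := index3 aI; have i3' := index3 aI'.
have hh : h = h' by apply: val_inj => /=; lia.
split=> //; subst h'; move: hI' aI' e i3'; rewrite hI => -[<-] aI' e _.
by apply: (index_avail_inj aI); lia.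
Qed.

Lemma root3_connected h : connect edge3 ord0 h.
Proof.
case: h => n; elim/ltn_ind: n => n IH nlt.
have [n0|n0] := eqVneq n 0%N.
  by have -> : Ordinal nlt = ord0 by exact: val_inj.
have plt : (n.-1 %/ 3 < 40)%N by lia.
have pn : (n.-1 %/ 3 < n)%N by lia.
apply: (connect_trans (IH _ pn plt)); apply: connect1.
have sz I : size (avail3 I) = 3%N by case: I.
have [I hI] : exists I, info3 (n.-1 %/ 3) = Some I.
  have : (n.-1 %/ 3 <= 12)%N by lia.
  by move: (_ %/ _)%N; do 13!(case=> [_|]; first by eexists).
rewrite /edge3 /= hI; set a := nth Other (avail3 I) (n.-1 %% 3)%N.
have aI : a \in avail3 I by rewrite mem_nth // sz ltn_mod.
apply/mapP; exists a => //; apply: val_inj => /=.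
rewrite (@next3E (Ordinal plt) I) //= index_uniq ?sz ?ltn_mod //; first by lia.
by have /andP[] := avail3_uniq I.
Qed.

Definition game3 (R : realType) (w c d ch z : R) : game R :=
  @Game R 'I_40 iset3 move ord0 (fun v => info3 v) owner3 avail3 next3
    (fun i v => pick_payoff i (payoff3 w c d ch z v))
    avail3_uniq iset3_inhabited root3_no_parent parent3_unique root3_connected.

Lemma info4E (v : nat) I : info4 v = Some I -> (v <= 14)%N.
Proof. by do 15!(case: v => // v). Qed.

Definition succ4 (v k : nat) : nat :=
  match v with
  | 0%N => if k == 0%N then 42%N else 1%N
  | 1%N => if k == 0%N then 43%N else 2%N
  | _ => (3 * v - 3 + k)%N
  end.

Lemma next4E (h : 'I_44) I a : info4 h = Some I -> a \in avail4 I ->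
  next4 h a = succ4 h (index a (avail4 I)) :> nat.
Proof.
move=> hI; rewrite -index_mem => aI.
have := info4E hI; move: hI aI; rewrite /next4.
case: h => -[|[|n]] nlt /= hI.
- by move: hI => [<-]; case: a => //= *; rewrite inordK.
- by move: hI => [<-]; case: a => //= *; rewrite inordK.
move=> aI nle.
have [I1 I0 sz] : [/\ I <> I4_v1, I <> I4_v0 & size (avail4 I) = 3%N].
  by move: hI; clear; do 13!(case: n => [[<-] //|n]).
rewrite hI; case: I {hI} aI I1 I0 sz => // aI _ _ sz; rewrite inordK //;
  move: aI; rewrite sz; lia.
Qed.

Definition edge4 : rel 'I_44 := fun h h' =>
  if info4 h is Some J then h' \in map (next4 h) (avail4 J) else false.

Lemma avail4_uniq I : uniq (avail4 I) && (avail4 I != [::]).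
Proof. by case: I. Qed.

Lemma iset4_inhabited I : exists h : 'I_44, info4 h = Some I.
Proof.
case: I; [exists (inord 0)|exists (inord 1)|exists (inord 2)|exists (inord 3)
  |exists (inord 6)|exists (inord 9)|exists (inord 12)]; by rewrite inordK.
Qed.

Lemma root4_no_parent h : ~~ edge4 h ord0.
Proof.
rewrite /edge4; case hI: (info4 h) => [I|//].
apply/negP => /mapP[a aI /(congr1 val)/=]; rewrite (next4E hI aI).
by case: (val h) => [|[|n]] /=; [case: ifP|case: ifP|lia].
Qed.

Lemma size_avail4 v I : info4 v = Some I ->
  size (avail4 I) = (if (v <= 1)%N then 2%N else 3%N).
Proof. by do 15!(case: v => [[<-] //|v]). Qed.

Lemma succ4_inj v v' k k' : (v <= 14)%N -> (v' <= 14)%N ->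
  (k < if v <= 1 then 2 else 3)%N -> (k' < if v' <= 1 then 2 else 3)%N ->
  succ4 v k = succ4 v' k' -> v = v' /\ k = k'.
Proof.
by case: v => [|[|v]]; case: v' => [|[|v']] /= *;
   repeat match goal with H : context[if ?b then _ else _] |- _ =>
     destruct b eqn:? end; lia.
Qed.

Lemma parent4_unique (h h' : 'I_44) I I' a a' :
  info4 h = Some I -> info4 h' = Some I' ->
  a \in avail4 I -> a' \in avail4 I' ->
  next4 h a = next4 h' a' -> h = h' /\ a = a'.
Proof.
move=> hI hI' aI aI' /(congr1 val)/=.
rewrite (next4E hI aI) (next4E hI' aI') => /succ4_inj[].
- exact: info4E hI.
- exact: info4E hI'.
- by rewrite -(size_avail4 hI) index_mem.
- by rewrite -(size_avail4 hI') index_mem.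
move=> /val_inj hh e; subst h'; split=> //.
by move: hI' aI' e; rewrite hI => -[<-] aI'; exact: index_avail_inj.
Qed.

Lemma parent4_exists n : (n < 44)%N -> n != 0%N ->
  exists v k, [/\ (v <= 14)%N, (k < if v <= 1 then 2 else 3)%N,
    succ4 v k = n & (v < n)%N].
Proof.
move=> nlt n0.
have [->|n1] := eqVneq n 1%N; first by exists 0%N, 1%N.
have [->|n2] := eqVneq n 2%N; first by exists 1%N, 1%N.
have [->|n42] := eqVneq n 42%N; first by exists 0%N, 0%N.
have [->|n43] := eqVneq n 43%N; first by exists 1%N, 0%N.
exists (n %/ 3).+1, (n %% 3)%N.
have n3 : (0 < n %/ 3)%N by lia.
by split; [lia|case: ifP; lia|case: (n %/ 3)%N n3 (divn_eq n 3) => //= *; lia|lia].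
Qed.

Lemma root4_connected h : connect edge4 ord0 h.
Proof.
case: h => n; elim/ltn_ind: n => n IH nlt.
have [n0|n0] := eqVneq n 0%N.
  by have -> : Ordinal nlt = ord0 by exact: val_inj.
have [v [k [v14 kv vk vn]]] := parent4_exists nlt n0.
have vlt : (v < 44)%N by lia.
apply: (connect_trans (IH _ vn vlt)); apply: connect1.
have [I hI] : exists I, info4 v = Some I.
  by move: v14; clear; do 15!(case: v => [|v]; first by eexists).
have sz := size_avail4 hI.
rewrite /edge4 /= hI; set a := nth Other (avail4 I) k.
have aI : a \in avail4 I by rewrite mem_nth // sz.
apply/mapP; exists a => //; apply: val_inj => /=.
rewrite (@next4E (Ordinal vlt) I) //= index_uniq ?sz //.
by have /andP[] := avail4_uniq I.
Qed.

Definition game4 (R : realType) (w c d ch b t z : R) : game R :=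
  @Game R 'I_44 iset4 move ord0 (fun v => info4 v) owner4 avail4 next4
    (fun i v => pick_payoff i (payoff4 w c d ch b t z v))
    avail4_uniq iset4_inhabited root4_no_parent parent4_unique root4_connected.

(* Main.v *)
(* Both games are solved backwards by strict dominance: each comparison below
   holds at every node of an information set and hence for every belief.
   Game 3: f(x) is TRA's strictly dominant reply after not reporting and after
   reporting y' <> f(x); then f(x) is strictly dominant for OTH, and not
   reporting for TRA.
   Game 4: as t + b > z + d, the action r is strictly dominant at all the last
   information sets of FLR.  Against r, LDR's payoff after collusion is negative
   whatever it does: if it plays f(x) surely it gets z - t - b; otherwise
   reporting y' = f(x) is strictly best for FLR, and LDR gets a mixture of
   z - t - b, - d - b and - d - t - b.  In both cases FLR earns more than w - c,
   hence colludes at v1, and LDR prefers the payoff w - c >= 0 of not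
   initiating. *)
Require Import Defs.
From HB Require Import structures.
From mathcomp Require Import all_boot all_order all_algebra.
From mathcomp Require Import zify lra.
From mathcomp Require Import all_classical all_reals all_analysis.

Set Implicit Arguments.
Unset Strict Implicit.

Import Order.TTheory GRing.Theory Num.Theory.

Local Open Scope ring_scope.

(** A positive total weight forces some positive weight. This carries strict inequalities through
    averages, over the actions of a mixed strategy as well as over the nodes under an arbitrary
    belief. *)
Lemma weighted_sum_gt0 (R : numDomainType) (T : eqType) (r : seq T) (p x : T -> R) :
  (forall a, a \in r -> 0 <= p a) -> 0 < \sum_(a <- r) p a ->
  (forall a, a \in r -> 0 < p a -> 0 < x a) -> 0 < \sum_(a <- r) p a * x a.
Proof.
elim: r => [|a r IH] p0; first by rewrite !big_nil ltxx.
rewrite !big_cons => sp x0.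
have p0r b : b \in r -> 0 <= p b by move=> br; apply: p0; rewrite inE br orbT.
have x0r b : b \in r -> 0 < p b -> 0 < x b.
  by move=> br; apply: x0; rewrite inE br orbT.
have ar : a \in a :: r by rewrite inE eqxx.
have [pa|pa] := boolP (0 < p a).
  apply: ltr_pwDl; first by rewrite mulr_gt0 // x0.
  rewrite big_seq sumr_ge0 // => b br; have := p0r b br.
  by rewrite le_eqVlt => /predU1P[<-|pb]; rewrite ?mul0r // ltW // mulr_gt0 // x0r.
have pa0 : p a = 0 by apply/eqP; move: (p0 _ ar); rewrite le_eqVlt (negbTE pa) orbF eq_sym.
by move: sp; rewrite pa0 mul0r !add0r => sp; apply: IH.
Qed.

(** * Backward recursion and one-shot deviations *)

(* Along every play the stages of the visited information sets increase, so a
   deviation confined to one information set leaves later payoffs unchanged. *)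
Section StagedGame.
Variables (R : realType) (G : game R) (stage : iset G -> nat).
Implicit Types (s : profile G) (h : node G) (I J : iset G) (a : action G).

Hypothesis stage_lt : forall h I a J, info G h = Some I -> a \in avail G I ->
  info G (child G h a) = Some J -> (stage I < stage J)%N.
Hypothesis stage_bound : forall I, (stage I < #|node G|)%N.

(** Bounds the number of moves still to come: 0 at terminal nodes, positive at decision nodes,
    decreasing along play. *)
Definition rank h : nat :=
  if info G h is Some J then (#|node G| - stage J)%N else 0%N.

Lemma rank_child h I a : info G h = Some I -> a \in avail G I ->
  (rank (child G h a) < rank h)%N.
Proof.
move=> hI aI; rewrite /rank hI.
have := stage_bound I; case E: (info G (child G h a)) => [J|]; last by lia.
by have := stage_lt hI aI E; lia.
Qed.

(** Once the fuel covers the remaining moves, extra fuel changes nothing; this frees [pr] from its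
    fixed fuel. *)
Lemma pr_within_stable s n m h h' : (rank h <= n)%N -> (rank h <= m)%N ->
  pr_within n s h h' = pr_within m s h h'.
Proof.
elim: n m h => [|n IH] [|m] h //=; case: ifP => // _; case hI: (info G h) => [I|] //.
- by have := stage_bound I; rewrite /rank hI; lia.
- by have := stage_bound I; rewrite /rank hI; lia.
move=> hn hm; apply: eq_big_seq => a aI; congr (_ * _).
by have := rank_child hI aI => ha; apply: IH; lia.
Qed.

Lemma rank_le h : (rank h <= #|node G|)%N.
Proof. by rewrite /rank; case: (info G h) => [I|] //; lia. Qed.

Lemma pr_refl s h : pr s h h = 1.
Proof. by rewrite /pr; case: #|node G| => [|n] /=; rewrite eqxx. Qed.

Lemma pr_step s h I h' : info G h = Some I -> h != h' ->
  pr s h h' = \sum_(a <- avail G I) s (owner G I) I a * pr s (child G h a) h'.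
Proof.
move=> hI /negbTE hh'.
(* One more unit of fuel, so that unfolding one move leaves exactly [pr] at the children. *)
rewrite {1}/pr (@pr_within_stable s _ (#|node G|).+1) ?rank_le ?(leqW (rank_le h)) //.
by rewrite /= hh' hI.
Qed.

Lemma pr_terminal s h h' : info G h = None -> pr s h h' = (h == h')%:R.
Proof.
by move=> hN; rewrite /pr; case: #|node G| => [|n] /=; rewrite ?hN; case: eqP.
Qed.

Lemma payoff_node_terminal i s h : info G h = None ->
  payoff_node i s h = payoff G i h.
Proof.
move=> hN; rewrite /payoff_node (bigD1 h) ?hN //= pr_refl mul1r big1 ?addr0 //.
by move=> h' /andP[_ hh']; rewrite pr_terminal // eq_sym (negbTE hh') mul0r.
Qed.

Lemma payoff_node_step i s h I : info G h = Some I ->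
  payoff_node i s h =
  \sum_(a <- avail G I) s (owner G I) I a * payoff_node i s (child G h a).
Proof.
move=> hI; under [RHS]eq_bigr do rewrite /payoff_node mulr_sumr.
rewrite exchange_big /=; apply: eq_bigr => h' /eqP h'N.
rewrite (pr_step _ hI); last by apply: contra_eq_neq h'N => <-; rewrite hI.
by rewrite mulr_suml; apply: eq_bigr => a _; rewrite mulrA.
Qed.

(** As the weights sum to 1, comparing a node with [m] becomes the sign of a weighted sum. *)
Lemma payoff_node_mean i s h I : behavior_profile s -> info G h = Some I ->
  forall m, \sum_(a <- avail G I) s (owner G I) I a *
      (payoff_node i s (child G h a) - m) = payoff_node i s h - m.
Proof.
move=> bs hI m; rewrite (payoff_node_step _ _ hI).
under eq_bigr do rewrite mulrBr.
by rewrite sumrB -mulr_suml; have [_ ->] := bs _ I erefl; rewrite mul1r.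
Qed.

Lemma payoff_node_gt i s h I m : behavior_profile s -> info G h = Some I ->
  (forall a, a \in avail G I -> m < payoff_node i s (child G h a)) ->
  m < payoff_node i s h.
Proof.
move=> bs hI lt; rewrite -subr_gt0 -(payoff_node_mean i bs hI).
have [s0 s1] := bs _ I erefl.
by apply: weighted_sum_gt0 => [//||a aI _]; rewrite ?s1 ?subr_gt0 // lt.
Qed.

Lemma payoff_node_lt i s h I m : behavior_profile s -> info G h = Some I ->
  (forall a, a \in avail G I -> payoff_node i s (child G h a) < m) ->
  payoff_node i s h < m.
Proof.
move=> bs hI lt; rewrite -subr_gt0 -opprB -(payoff_node_mean i bs hI) -sumrN.
under eq_bigr do rewrite -mulrN opprB.
have [s0 s1] := bs _ I erefl.
by apply: weighted_sum_gt0 => [//||a aI _]; rewrite ?s1 ?subr_gt0 // lt.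
Qed.

Definition pure_at s I a0 : strategy G :=
  fun J a => if J == I then (a == a0)%:R else s (owner G I) J a.

Definition switch s I a0 : profile G := deviate s (owner G I) (pure_at s I a0).

Lemma switch_off s I a0 J a : J != I -> switch s I a0 (owner G J) J a = s (owner G J) J a.
Proof. by move=> /negbTE JI; rewrite /switch /deviate /pure_at; case: eqP => // ->; rewrite JI. Qed.

Lemma switch_on s I a0 a : switch s I a0 (owner G I) I a = (a == a0)%:R.
Proof. by rewrite /switch /deviate /pure_at !eqxx. Qed.

Lemma sum_pure I a0 (f : action G -> R) : a0 \in avail G I ->
  \sum_(a <- avail G I) (a == a0)%:R * f a = f a0.
Proof.
move=> a0I; have /andP[uI _] := avail_uniq I.
rewrite (bigD1_seq a0) //= eqxx mul1r big1 ?addr0 // => a /negbTE ->.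
by rewrite mul0r.
Qed.

Lemma payoff_node_switch i s I a0 h :
  (forall J, info G h = Some J -> (stage I < stage J)%N) ->
  payoff_node i (switch s I a0) h = payoff_node i s h.
Proof.
move: {2}(rank h).+1 (ltnSn (rank h)) => n; elim: n h => // n IH h hn Ih.
case hJ: (info G h) => [J|]; last by rewrite !payoff_node_terminal.
rewrite !(payoff_node_step _ _ hJ); apply: eq_big_seq => a aJ.
have IJ := Ih _ hJ.
rewrite switch_off; last by apply: contraTneq IJ => ->; rewrite ltnn.
congr (_ * _); apply: IH; first by have := rank_child hJ aJ; lia.
by move=> K hK; apply: (ltn_trans IJ); exact: stage_lt hK.
Qed.

(** Sequential rationality is applied to the deviation to [a0] at [I] alone; by [payoff_node_switch]
    the payoffs after [a0] are still those of [s]. *)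
Lemma one_shot_deviation s beta I a0 : behavior_profile s ->
  sequentially_rational s beta -> a0 \in avail G I ->
  \sum_(h | info G h == Some I) beta h * payoff_node (owner G I) s (child G h a0)
  <= \sum_(h | info G h == Some I) beta h * payoff_node (owner G I) s h.
Proof.
move=> bs sr a0I; apply: le_trans (sr _ I erefl (pure_at s I a0) _); last first.
  move=> J oJ; rewrite /pure_at; case: (eqVneq J I) => [->|_]; last exact: bs oJ.
  split=> [a _|] /=; first by rewrite ler0n.
  by rewrite -[RHS](sum_pure (fun=> 1) a0I); apply: eq_bigr => a _; rewrite mulr1.
rewrite -/(switch s I a0) /payoff_iset le_eqVlt; apply/predU1P; left.
apply: eq_bigr => h /eqP hI; congr (_ * _).
rewrite (payoff_node_step _ _ hI).
under [RHS]eq_bigr do rewrite switch_on.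
rewrite (sum_pure _ a0I) payoff_node_switch // => J.
exact: stage_lt hI a0I.
Qed.

(** If another action had positive probability, switching to [a0] would gain strictly at each node
    of [I], hence on average under [beta], against [one_shot_deviation]. *)
Lemma strictly_dominant_action s beta I a0 :
  behavior_profile s -> belief_system beta -> sequentially_rational s beta ->
  a0 \in avail G I ->
  (forall h a, info G h = Some I -> a \in avail G I -> a != a0 ->
    payoff_node (owner G I) s (child G h a) <
    payoff_node (owner G I) s (child G h a0)) ->
  forall a, a \in avail G I -> s (owner G I) I a = (a == a0)%:R.
Proof.
move=> bs bb sr a0I dom.
have [s0 s1] := bs _ I erefl; have [b0 b1] := bb I.
have /andP[uI _] := avail_uniq I.
have other a : a \in avail G I -> a != a0 -> s (owner G I) I a = 0.
  move=> aI aa0; apply/eqP; rewrite eq_le s0 // andbT leNgt; apply/negP => sa.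
  have := one_shot_deviation bs sr a0I; apply/negP; rewrite -ltNge -subr_gt0.
  rewrite -sumrB; under eq_bigr do rewrite -mulrBr.
  rewrite -big_filter; apply: weighted_sum_gt0.
  - by move=> h; rewrite mem_filter => /andP[/eqP /b0].
  - by rewrite big_filter b1 ltr01.
  move=> h; rewrite mem_filter => /andP[/eqP hI _] _.
  (* The gain at [h] is the mean under [s] of the gains over single actions: the term of [a] is
     positive, the others are nonnegative. *)
  rewrite -opprB -(payoff_node_mean _ bs hI) -sumrN.
  rewrite (bigD1_seq a) //= ltr_pwDl //.
    by rewrite -mulrN opprB mulr_gt0 // subr_gt0 dom.
  rewrite big_seq_cond sumr_ge0 // => a' /andP[a'I _].
  rewrite -mulrN opprB mulr_ge0 ?s0 // subr_ge0.
  by have [->|/(dom h a' hI a'I)/ltW] := eqVneq a' a0.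
move=> a aI; have [->|/(other a aI)//] := eqVneq a a0.
rewrite -s1 (bigD1_seq a0) //= big_seq_cond big1 ?addr0 // => a' /andP[].
exact: other.
Qed.

Lemma pr_pure_action s h I a0 h' : info G h = Some I -> a0 \in avail G I ->
  (forall a, a \in avail G I -> s (owner G I) I a = (a == a0)%:R) ->
  h != h' -> pr s h h' = pr s (child G h a0) h'.
Proof.
move=> hI a0I pure hh'; rewrite (pr_step _ hI hh') -(sum_pure (fun a => pr s (child G h a) h') a0I).
by apply: eq_big_seq => a aI; rewrite pure.
Qed.

Lemma payoff_node_pure_action i s h I a0 : info G h = Some I ->
  a0 \in avail G I ->
  (forall a, a \in avail G I -> s (owner G I) I a = (a == a0)%:R) ->
  payoff_node i s h = payoff_node i s (child G h a0).
Proof.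
move=> hI a0I pure; rewrite (payoff_node_step _ _ hI).
rewrite -(sum_pure (fun a => payoff_node i s (child G h a)) a0I).
by apply: eq_big_seq => a aI; rewrite pure.
Qed.

End StagedGame.

(* A numbering of the decision nodes by naturals, under which [kid] computes
   with literals whereas [child] on ordinals does not. *)
Record numbering (R : realType) (G : game R) := Numbering {
  stage : iset G -> nat;
  num : nat -> node G;
  kid : nat -> action G -> nat;
  nodes : iset G -> seq nat;
  stage_bound : forall I, (stage I < #|node G|)%N;
  info_num : forall I v, v \in nodes I -> info G (num v) = Some I;
  num_onto : forall I h, info G h = Some I -> exists2 v, v \in nodes I & h = num v;
  child_num : forall I v a, v \in nodes I -> a \in avail G I ->
    child G (num v) a = num (kid v a);
  kid_stage : forall I J v a, v \in nodes I -> a \in avail G I ->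
    info G (num (kid v a)) = Some J -> (stage I < stage J)%N
}.

(** * Equilibrium values on numbered nodes *)

Section NumberedGame.

Variables (R : realType) (G : game R) (N : numbering G).
Variables (s : profile G) (beta : belief G).
Hypothesis seq_eq : sequential_equilibrium s beta.
Implicit Types (i : player) (I : iset G) (v : nat) (a : action G).

Let bs : behavior_profile s. Proof. by case: seq_eq. Qed.

Let stage_lt (h : node G) I a (J : iset G) : info G h = Some I ->
  a \in avail G I -> info G (child G h a) = Some J ->
  (stage N I < stage N J)%N.
Proof.
by move=> /(num_onto N)[v vI ->] aI; rewrite (child_num vI aI); apply: kid_stage.
Qed.

Definition value i v : R := payoff_node i s (num N v).

Definition plays I a0 : Prop :=
  forall a, a \in avail G I -> s (owner G I) I a = (a == a0)%:R.

Lemma value_terminal i v : info G (num N v) = None ->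
  value i v = payoff G i (num N v).
Proof. exact: payoff_node_terminal. Qed.

Lemma value_step I i v : v \in nodes N I -> value i v =
  \sum_(a <- avail G I) s (owner G I) I a * value i (kid N v a).
Proof.
move=> vI; rewrite /value (payoff_node_step stage_lt (stage_bound N) _ _ (info_num vI)).
by apply: eq_big_seq => a aI; rewrite (child_num vI aI).
Qed.

Lemma value_gt I i v m : v \in nodes N I ->
  (forall a, a \in avail G I -> m < value i (kid N v a)) -> m < value i v.
Proof.
move=> vI lt; apply: (payoff_node_gt stage_lt (stage_bound N) bs (info_num vI)).
by move=> a aI; rewrite (child_num vI aI); exact: lt.
Qed.

Lemma value_lt I i v m : v \in nodes N I ->
  (forall a, a \in avail G I -> value i (kid N v a) < m) -> value i v < m.
Proof.
move=> vI lt; apply: (payoff_node_lt stage_lt (stage_bound N) bs (info_num vI)).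
by move=> a aI; rewrite (child_num vI aI); exact: lt.
Qed.

Lemma dominant_plays I a0 : a0 \in avail G I ->
  (forall v a, v \in nodes N I -> a \in avail G I -> a != a0 ->
    value (owner G I) (kid N v a) < value (owner G I) (kid N v a0)) ->
  plays I a0.
Proof.
move=> a0I lt; have [_ bb sr _] := seq_eq.
apply: (strictly_dominant_action stage_lt (stage_bound N) bs bb sr a0I).
move=> _ a /(num_onto N)[v vI ->] aI aa0.
by rewrite !(child_num vI) //; apply: lt.
Qed.

Lemma value_plays I i v a0 : v \in nodes N I -> a0 \in avail G I ->
  plays I a0 -> value i v = value i (kid N v a0).
Proof.
move=> vI a0I pl; rewrite /value -(child_num vI a0I).
exact: (payoff_node_pure_action stage_lt (stage_bound N) i (info_num vI) a0I pl).
Qed.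

Lemma pr_plays I h v a0 : v \in nodes N I -> a0 \in avail G I ->
  plays I a0 -> info G h = None ->
  pr s (num N v) h = pr s (num N (kid N v a0)) h.
Proof.
move=> vI a0I pl hN; rewrite -(child_num vI a0I).
apply: (pr_pure_action stage_lt (stage_bound N) (info_num vI) a0I pl).
by apply: contra_eq_neq hN => <-; rewrite (info_num vI).
Qed.

End NumberedGame.

(** One table serves both games, since a move has the same position in every [avail] list that
    offers it. *)
Definition slot (a : move) : nat :=
  match a with
  | Init | Collude | Rr | ReportEq => 1 | Other | ReportNeq => 2 | _ => 0
  end.

(** * Backward solution of Game 3 *)

Section Game3.

Variables (R : realType) (w c d ch z : R).
Local Notation G := (game3 w c d ch z).

(** Constructors and [coq_nat] addition let [/=] reduce literals to literals. *)
Definition kid3 (v : nat) (a : move) : nat := S (slot a + (v + (v + v)))%coq_nat.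

Definition nodes3 (I : iset3) : seq nat :=
  match I with
  | I3_v0 => [:: 0] | I3_v1_3 => [:: 1; 2; 3] | I3_v4_6 => [:: 4; 5; 6]
  | I3_v7_9 => [:: 7; 8; 9] | I3_v10_12 => [:: 10; 11; 12]
  end%N.

Lemma mem_nodes3 v I : (v \in nodes3 I) = (info3 v == Some I).
Proof.
by do 13!(case: v => [|v]; first by case: I); case: I; rewrite !inE.
Qed.

Lemma next3_inord v I a : info3 v = Some I -> a \in avail3 I ->
  next3 (inord v) a = inord (kid3 v a).
Proof.
move=> vI aI; have v12 := info3E vI.
have vK : (inord v : 'I_40) = v :> nat by rewrite inordK //; lia.
rewrite -[LHS]inord_val (@next3E _ I) ?vK //; congr inord.
have -> : index a (avail3 I) = slot a by case: I a {vI} aI => -[].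
by rewrite /kid3; lia.
Qed.

(** The codes increase along play and so serve as stages. Transparent, so that [kid] and [nodes]
    compute. *)
Definition numbering3 : numbering G.
Proof.
apply: (@Numbering R G iset3_code (fun v => inord v : 'I_40) kid3 nodes3).
- by move=> I; rewrite card_ord; case: I.
- move=> I v; rewrite mem_nodes3 => /eqP vI; have := info3E vI => v12.
  by rewrite /= inordK //; lia.
- by move=> I h hI; exists (nat_of_ord h); rewrite ?inord_val // mem_nodes3; apply/eqP.
- by move=> I v a; rewrite mem_nodes3 => /eqP; exact: next3_inord.
- move=> I J v a; rewrite mem_nodes3 => /eqP.
  by do 13!(case: v => [[<-]|v];
    first by case: a => //= _; rewrite inordK //= => -[<-]).
Defined.

Variables (s : profile G) (beta : belief G).
Hypothesis seq_eq : sequential_equilibrium s beta.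

Local Notation V := (value numbering3 s).

Lemma value3_terminal i v : (v < 40)%N -> info3 v = None ->
  V i v = pick_payoff i (payoff3 w c d ch z v).
Proof. by move=> v40 vN; rewrite value_terminal /= inordK. Qed.

Lemma game3_outcome : 0 <= c -> 0 < ch -> c <= w -> c + ch < d ->
  z = w - c + d - ch -> pr s (root_node G) (inord 13) = 1.
Proof.
move=> c_ge0 ch_gt0 w_ge_c d_gt z_def.
have dominant := @dominant_plays _ _ numbering3 _ _ seq_eq.
have lt79 := @value_lt _ _ numbering3 _ _ seq_eq I3_v7_9.
have gt79 := @value_gt _ _ numbering3 _ _ seq_eq I3_v7_9.
(* At v5, f(x) beats r by z - w = d - c - ch, positive by [c + ch < d]. *)
have p46 : plays s I3_v4_6 Fx.
  apply: dominant => // v a; rewrite !inE => /or3P[]/eqP->; case: a => //= _ _;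
  rewrite !value3_terminal //=; lra.
have p1012 : plays s I3_v10_12 Fx.
  apply: dominant => // v a; rewrite !inE => /or3P[]/eqP->; case: a => //= _ _;
  rewrite !value3_terminal //=; lra.
have v4 i : V i 4 = pick_payoff i (w - c, w - c).
  by rewrite (value_plays _ _ _ p46) // value3_terminal.
have v5 i : V i 5 = pick_payoff i (- d, z).
  by rewrite (value_plays _ _ _ p46) // value3_terminal.
have v6 i : V i 6 = pick_payoff i (- d, z).
  by rewrite (value_plays _ _ _ p46) // value3_terminal.
have v10 i : V i 10 = pick_payoff i (w - c, w - c - ch).
  by rewrite (value_plays _ _ _ p1012) // value3_terminal.
have v11 i : V i 11 = pick_payoff i (- d, z).
  by rewrite (value_plays _ _ _ p1012) // value3_terminal.
have v12 i : V i 12 = pick_payoff i (- d, z).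
  by rewrite (value_plays _ _ _ p1012) // value3_terminal.
(* The belief on {v7, v8, v9} may vanish at v7, so TRA's reply there is not
   determined; these bounds hold for every reply. *)
have v7_gt : - (c + ch) < V P1 7.
  by apply: gt79 => // -[] //= _; rewrite value3_terminal //=; lra.
have v8_lt : V P1 8 < - (c + ch).
  by apply: lt79 => // -[] //= _; rewrite value3_terminal //=; lra.
have v9_lt : V P1 9 < - (c + ch).
  by apply: lt79 => // -[] //= _; rewrite value3_terminal //=; lra.
(* At v2 the constant -(c + ch) separates v7 from v8 and v9, as -d < -(c + ch) < 0 <= w - c. At v1
   and v3, f(x) yields w - c against -d. *)
have p13 : plays s I3_v1_3 Fx.
  apply: dominant => // v a; rewrite !inE => /or3P[]/eqP->; case: a => //= _ _;
  rewrite ?v4 ?v5 ?v6 ?v10 ?v11 ?v12 //=; lra.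
have v1 : V P2 1 = w - c by rewrite (value_plays _ _ _ p13) //= v4.
have v2 : V P2 2 = V P2 7 by rewrite (value_plays _ _ _ p13).
have v3 : V P2 3 = w - c - ch by rewrite (value_plays _ _ _ p13) //= v10.
(* Every reply at v7 costs TRA either ch or d relative to w - c, so its reply there need not be
   identified. *)
have v7_lt : V P2 7 < w - c.
  by apply: lt79 => // -[] //= _; rewrite value3_terminal //=; lra.
have p0 : plays s I3_v0 NotReport.
  apply: dominant => // v a; rewrite !inE => /eqP->; case: a => //= _ _;
  rewrite v1 ?v2 ?v3; lra.
have -> : root_node G = num numbering3 0 by apply: val_inj; rewrite /= inordK.
have v13 : info G (inord 13 : 'I_40) = None by rewrite /= inordK.
rewrite (pr_plays _ _ p0) // (pr_plays _ _ p13) // (pr_plays _ _ p46) //.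
exact: pr_refl.
Qed.

End Game3.

(** * Backward solution of Game 4 *)

Section Game4.
Variables (R : realType) (w c d ch b t z : R).
Local Notation G := (game4 w c d ch b t z).

(** For v = n + 2 the index 3v - 3 + [slot a] becomes 3n + 3 + [slot a], free of subtraction. *)
Definition kid4 (v : nat) (a : move) : nat :=
  match v with
  | 0 => if slot a is 0 then 42 else 1
  | 1 => if slot a is 0 then 43 else 2
  | S (S n) => S (S (S (slot a + (n + (n + n)))))%coq_nat
  end.

Definition nodes4 (I : iset4) : seq nat :=
  match I with
  | I4_v0 => [:: 0] | I4_v1 => [:: 1] | I4_v2 => [:: 2]
  | I4_v3_5 => [:: 3; 4; 5] | I4_v6_8 => [:: 6; 7; 8]
  | I4_v9_11 => [:: 9; 10; 11] | I4_v12_14 => [:: 12; 13; 14]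
  end%N.

Lemma mem_nodes4 v I : (v \in nodes4 I) = (info4 v == Some I).
Proof.
by do 15!(case: v => [|v]; first by case: I); case: I; rewrite !inE.
Qed.

Lemma next4_inord v I a : info4 v = Some I -> a \in avail4 I ->
  next4 (inord v) a = inord (kid4 v a).
Proof.
move=> vI aI; have v14 := info4E vI.
have vK : (inord v : 'I_44) = v :> nat by rewrite inordK //; lia.
rewrite -[LHS]inord_val (@next4E _ I) ?vK //; congr inord.
have -> : index a (avail4 I) = slot a by case: I a {vI} aI => -[].
by case: v {vI v14 vK} => [|[|v]] /=; [case: slot|case: slot|lia].
Qed.

Definition numbering4 : numbering G.
Proof.
apply: (@Numbering R G iset4_code (fun v => inord v : 'I_44) kid4 nodes4).
- by move=> I; rewrite card_ord; case: I.
- move=> I v; rewrite mem_nodes4 => /eqP vI; have := info4E vI => v14.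
  by rewrite /= inordK //; lia.
- by move=> I h hI; exists (nat_of_ord h); rewrite ?inord_val // mem_nodes4; apply/eqP.
- by move=> I v a; rewrite mem_nodes4 => /eqP; exact: next4_inord.
- move=> I J v a; rewrite mem_nodes4 => /eqP.
  by do 15!(case: v => [[<-]|v];
    first by case: a => //= _; rewrite inordK //= => -[<-]).
Defined.

Variables (s : profile G) (beta : belief G).
Hypothesis seq_eq : sequential_equilibrium s beta.

Local Notation V := (value numbering4 s).

Lemma value4_terminal i v : (v < 44)%N -> info4 v = None ->
  V i v = pick_payoff i (payoff4 w c d ch b t z v).
Proof. by move=> v44 vN; rewrite value_terminal /= inordK. Qed.

Lemma game4_plays_notinit : 0 <= b -> 0 <= t -> c <= w -> 2 * w < ch ->
  z = w - c + d - ch -> c + ch < d -> b < c -> z + d - b < t ->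
  plays s I4_v0 NotInit.
Proof.
move=> b_ge0 t_ge0 w_ge_c ch_gt z_def d_gt b_lt_c t_gt.
have z_gt : w < z by lra.
have d_gt0 : 0 < d by lra.
have w_ch : w - c < ch by lra.
move=> {z_def d_gt}.
have dominant := @dominant_plays _ _ numbering4 _ _ seq_eq.
(* At v8, and below at v13 and v14, r beats f(x) by exactly t + b - z - d. *)
have p68 : plays s I4_v6_8 Rr.
  apply: dominant => // v a; rewrite !inE => /or3P[]/eqP->; case: a => //= _ _;
  rewrite !value4_terminal //=; lra.
have p911 : plays s I4_v9_11 Rr.
  apply: dominant => // v a; rewrite !inE => /or3P[]/eqP->; case: a => //= _ _;
  rewrite !value4_terminal //=; lra.
have p1214 : plays s I4_v12_14 Rr.
  apply: dominant => // v a; rewrite !inE => /or3P[]/eqP->; case: a => //= _ _;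
  rewrite !value4_terminal //=; lra.
have [bs _ _ _] := seq_eq; have [s0 s1] := bs P1 I4_v3_5 erefl.
(* LDR's mixture stays symbolic: if z + d - b < t < z + d, then r beats f(x) at v3 but f(x) beats r
   at v4. *)
pose p := s P1 I4_v3_5 Fx; pose q := s P1 I4_v3_5 Rr; pose o := s P1 I4_v3_5 Other.
have p_ge0 : 0 <= p by exact: s0.
have q_ge0 : 0 <= q by exact: s0.
have o_ge0 : 0 <= o by exact: s0.
have pqo : p + (q + o) = 1 by rewrite -s1 /= !big_cons big_nil addr0.
have mixE i v : v \in nodes4 I4_v3_5 ->
    V i v = p * V i (kid4 v Fx) + (q * V i (kid4 v Rr) + o * V i (kid4 v Other)).
  move=> vI; rewrite (@value_step _ _ numbering4 s I4_v3_5 i v vI) /=.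
  by rewrite !big_cons big_nil addr0.
have v3 i : V i 3 = p * pick_payoff i (z - t - b, - d + t + b) +
    (q * pick_payoff i (w - b, w + b) +
     o * pick_payoff i (- d - t - b, - d + t + b)).
  rewrite mixE //; congr (_ * _ + (_ * _ + _ * _));
  by rewrite (value_plays _ _ _ p68) // value4_terminal.
have v4 i : V i 4 = p * pick_payoff i (z - t - b, - d + w - c + t + b) +
    (q * pick_payoff i (- d - b, z + b) +
     o * pick_payoff i (- d - t - b, z + t + b)).
  rewrite mixE //; congr (_ * _ + (_ * _ + _ * _));
  by rewrite (value_plays _ _ _ p911) // value4_terminal.
have v5 i : V i 5 = p * pick_payoff i (z - t - b, - d + t + b) +
    (q * pick_payoff i (- d - b, - d + b) +
     o * pick_payoff i (- d - t - b, - d + t + b)).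
  rewrite mixE //; congr (_ * _ + (_ * _ + _ * _));
  by rewrite (value_plays _ _ _ p1214) // value4_terminal.
have {mixE s0 s1} [v2_lt v2_gt] : V P1 2 < 0 /\ w - c < V P2 2.
  (* If LDR plays f(x) surely and w = c, FLR is indifferent at v2; in this case the bounds are
     checked after each of its moves. *)
  have [qo|qo] := eqVneq (q + o) 0.
    have [q0 o0 p1] : [/\ q = 0, o = 0 & p = 1] by split; lra.
    split.
      apply: (@value_lt _ _ numbering4 _ _ seq_eq I4_v2) => // -[] //= _;
      rewrite ?v3 ?v4 ?v5 q0 o0 p1 /=; lra.
    apply: (@value_gt _ _ numbering4 _ _ seq_eq I4_v2) => // -[] //= _;
    rewrite ?v3 ?v4 ?v5 q0 o0 p1 /=; lra.
  have pE : p = 1 - (q + o) by lra.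
  have qo_gt0 : 0 < q + o by rewrite lt_neqAle eq_sym qo addr_ge0.
  have p2 : plays s I4_v2 ReportEq.
    (* FLR's gain from y' = f(x) is p(w - c) + (q + o)(z - w) + o(w + d) over not reporting, and p(w
       - c) + (q + o)(z + d) over y' <> f(x). *)
    have h1 : 0 <= p * (w - c) by rewrite mulr_ge0 // subr_ge0.
    have h2 : 0 < (q + o) * (z - w) by rewrite mulr_gt0 // subr_gt0.
    have h3 : 0 <= o * (w + d) by rewrite mulr_ge0 //; lra.
    have h4 : 0 < (q + o) * (z + d) by rewrite mulr_gt0 //; lra.
    apply: dominant => // v a; rewrite !inE => /eqP->; case: a => //= _ _;
    rewrite ?v3 ?v5 v4 /=; lra.
  rewrite !(@value_plays _ _ numbering4 _ I4_v2 _ 2%N ReportEq isT isT p2) /= !v4 /=.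
  split.
    (* LDR's loss at v4 is d plus these three terms. Substituting [pE] makes the identity linear in
       the monomials. *)
    have h1 : 0 <= p * (t + b - d - z) by rewrite mulr_ge0 //; lra.
    have h2 : 0 <= q * b by rewrite mulr_ge0.
    have h3 : 0 <= o * (t + b) by rewrite mulr_ge0 // addr_ge0.
    rewrite pE in h1 *; lra.
  (* FLR's surplus over w - c is z - w > 0 plus these three terms. *)
  have h1 : 0 <= p * (t + b - d - (z - w)) by rewrite mulr_ge0 //; lra.
  have h2 : 0 <= q * (b + c) by rewrite mulr_ge0 //; lra.
  have h3 : 0 <= o * (t + b + c) by rewrite mulr_ge0 //; lra.
  rewrite pE in h1 *; lra.
have p1 : plays s I4_v1 Collude.
  apply: dominant => // v a; rewrite !inE => /eqP->; case: a => //= _ _.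
  by rewrite value4_terminal.
have v1 : V P1 1 = V P1 2 by rewrite (value_plays _ _ _ p1).
apply: dominant => // v a; rewrite !inE => /eqP->; case: a => //= _ _.
rewrite v1 (@value4_terminal _ 42) //=; lra.
Qed.

End Game4.

(** * Outcome of both games *)

Theorem theorem7p4 (R : realType) (w c d ch b t z : R)
  (w_ge0 : 0 <= w) (c_ge0 : 0 <= c) (d_ge0 : 0 <= d) (ch_ge0 : 0 <= ch)
  (b_ge0 : 0 <= b) (t_ge0 : 0 <= t)
  (w_ge_c : c <= w) (ch_gt_2w : 2 * w < ch)
  (z_def : z = w - c + d - ch)
  (d_gt : c + ch < d) (b_lt_c : b < c) (t_gt : z + d - b < t) :
  (forall (s : profile (game4 w c d ch b t z))
          (beta : belief (game4 w c d ch b t z)),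
     sequential_equilibrium s beta ->
     s P1 I4_v0 NotInit = 1 /\
     pr s (root_node (game4 w c d ch b t z)) game3_after_notinit = 1) /\
  (forall (s : profile (game3 w c d ch z)) (beta : belief (game3 w c d ch z)),
     sequential_equilibrium s beta ->
     pr s (root_node (game3 w c d ch z)) (inord 13) = 1).
Proof.
split=> s beta seq_eq; last by apply: (game3_outcome seq_eq) => //; lra.
have p0 : plays s I4_v0 NotInit by apply: (game4_plays_notinit seq_eq).
split; first by rewrite (p0 NotInit).
have -> : root_node _ = num (numbering4 w c d ch b t z) 0.
  by apply: val_inj; rewrite /= inordK.
rewrite (pr_plays _ _ p0) //; first exact: pr_refl.
by rewrite /= inordK.
Qed.
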